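(* Let $n\ge 1$ and let $w=(w_1,\dots,w_n)\in\mathbb{R}^n$ satisfy $w_1\ge w_2\ge\cdots\ge w_n\ge 0$ and $w_1>0$, and let $\Omega_w(x)=\sum_{i=1}^n w_i|\grave{x}_i|$ be the associated DWSL1 norm on $\mathbb{R}^n$. Then its dual norm $\Omega_w^*(x)=\max\{\langle u,x\rangle : u\in\mathbb{R}^n,\ \Omega_w(u)\le 1\}$ is given, for every $x\in\mathbb{R}^n$, by $$\Omega_w^*(x)=\max\bigl\{\tau_k\,\|x_{(k)}\|_1 : k=1,\dots,n\bigr\},\qquad \tau_k=\Bigl(\sum_{j=1}^k w_j\Bigr)^{-1}.$$
   Context: For $x\in\mathbb{R}^n$, $\grave{x}\in\mathbb{R}^n$ denotes the vector obtained from $x$ by sorting its entries in non-increasing order of magnitude, so $|\grave{x}_1|\ge\cdots\ge|\grave{x}_n|$ (ties broken by an arbitrary fixed rule). The vector $x_{(k)}\in\mathbb{R}^n$ is obtained from $\grave{x}$ by keeping its $k$ largest (in magnitude) entries and setting the others to zero, so that $\|x_{(k)}\|_1=\sum_{i=1}^k|\grave{x}_i|$. *)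

(* Defs.v *)
From mathcomp Require Export all_boot all_order all_algebra.
From mathcomp Require Export classical_sets reals.

Set Implicit Arguments.
Unset Strict Implicit.
Unset Printing Implicit Defensive.

Import Order.TTheory GRing.Theory Num.Theory.

Local Open Scope classical_set_scope.
Local Open Scope ring_scope.

Section Defs.
Context {R : realType} {n : nat}.
Implicit Types u x w : 'rV[R]_n.

(* The library sort is stable, so ties in magnitude keep the original order
   of the indices. *)
Definition abs_sort x : 'rV[R]_n :=
  \row_(i < n) nth 0 (sort (fun a b : R => `|b| <= `|a|)
                           [seq x 0 j | j : 'I_n]) i.

Definition trunc_sort (k : nat) x : 'rV[R]_n :=
  \row_(i < n) (if (i < k)%N then abs_sort x 0 i else 0).

Definition l1norm x : R := \sum_(i < n) `|x 0 i|.

Definition inner u x : R := \sum_(i < n) u 0 i * x 0 i.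

Definition dwsl1 w x : R := \sum_(i < n) w 0 i * `|abs_sort x 0 i|.

(* Indices are shifted: w_1, ..., w_k are the entries at 0, ..., k - 1. *)
Definition tau w (k : nat) : R := (\sum_(j < n | (j < k)%N) w 0 j)^-1.

Definition dual_values (N : 'rV[R]_n -> R) x : set R :=
  [set inner u x | u in [set u | N u <= 1]].

(* [sup] is 0 by convention on a set without a supremum, so that this is the
   maximum of the dual values only when [is_max] below holds. *)
Definition dual_norm (N : 'rV[R]_n -> R) x : R := sup (dual_values N x).

End Defs.

Definition is_max {R : realType} (A : set R) (m : R) : Prop :=
  A m /\ ubound A m.

(* Main.v *)
(** For sorted magnitudes [a] of [u], summation by parts writes [\sum_i a_i c_i]
    as a nonnegative combination of the partial sums of [c]; taking for [c] the
    entries of [|x|] reordered as [u], each partial sum is at most the sum of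
    the [k] largest magnitudes of [x], hence at most [M \sum_(i < k) w_i] with
    [M] the claimed maximum.  This gives [inner u x <= M * dwsl1 w u].
    Conversely the [k]-th value is attained at [tau_k] times the sign vector of
    [x] restricted to [k] entries of largest magnitude. *)
Require Import Defs.
From mathcomp Require Import all_fingroup.

Set Implicit Arguments.
Unset Strict Implicit.
Unset Printing Implicit Defensive.

Import Order.TTheory GRing.Theory Num.Theory.
Local Open Scope classical_set_scope.
Local Open Scope ring_scope.

Lemma big_ord_ltS (V : nmodType) (n : nat) (F : 'I_n -> V) (k : nat)
    (kn : (k < n)%N) :
  \sum_(i < n | (i < k.+1)%N) F i =
  \sum_(i < n | (i < k)%N) F i + F (Ordinal kn).
Proof.
rewrite (bigD1 (Ordinal kn)) ?ltnSn //= addrC; congr (_ + _).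
by apply: eq_bigl => i; rewrite ltnS ltn_neqAle andbC.
Qed.

(** Summation by parts run as an induction: [a k] times the partial sum of [h] through [k] stays
    below the partial sum of [a i * h i], because passing to the smaller next value of [a] can only
    shrink its product with a nonnegative partial sum. At the last index this lower bound is itself
    nonnegative. *)
Lemma sumr_ge0_by_parts (R : numDomainType) (n : nat) (a h : 'I_n -> R)
    (a_noninc : forall i j : 'I_n, (i <= j)%N -> a j <= a i)
    (a_ge0 : forall i, 0 <= a i)
    (h_ge0 : forall k : 'I_n, 0 <= \sum_(i < n | (i < k.+1)%N) h i) :
  0 <= \sum_(i < n) a i * h i.
Proof.
have step k (kn : (k < n)%N) : a (Ordinal kn) * \sum_(i < n | (i < k.+1)%N) h i
    <= \sum_(i < n | (i < k.+1)%N) a i * h i.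
  elim: k kn => [|k IH] kn.
    rewrite !(big_ord_ltS _ kn).
    by rewrite ![\sum_(i < n | (i < 0)%N) _]big_pred0_eq !add0r.
  rewrite !(big_ord_ltS _ kn) mulrDr lerD2r.
  apply: le_trans (IH (ltnW kn)); apply: ler_wpM2r.
    exact: (h_ge0 (Ordinal (ltnW kn))).
  exact: a_noninc.
case: n a h a_noninc a_ge0 h_ge0 step => [|n] a h _ a_ge0 h_ge0 step.
  by rewrite big_ord0.
have := step n (ltnSn n).
rewrite [X in _ <= X -> _](eq_bigl predT); last by move=> i; rewrite ltn_ord.
by apply: le_trans; rewrite mulr_ge0 // (h_ge0 (Ordinal (ltnSn n))).
Qed.

Lemma ler_sum_perm_lt (R : numDomainType) (n : nat) (b : 'I_n -> R)
    (p : {perm 'I_n}) (k : 'I_n)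
    (b_noninc : forall i j : 'I_n, (i <= j)%N -> b j <= b i) :
  \sum_(i < n | (p i < k.+1)%N) b i <= \sum_(i < n | (i < k.+1)%N) b i.
Proof.
have cst : \sum_(i < n | (p i < k.+1)%N) b k = \sum_(i < n | (i < k.+1)%N) b k.
  by rewrite [RHS](reindex_inj (@perm_inj _ p)).
(* Both index sets have the same size, so [b k] may be subtracted from every
   term; the terms then have a sign on each side of [k]. *)
rewrite -(lerD2r (- \sum_(i < n | (p i < k.+1)%N) b k)) {2}cst -!sumrB.
rewrite big_mkcond [leRHS]big_mkcond; apply: ler_sum => i _.
case: (ltnP i k.+1) => ik; case: ifP => // _.
  by rewrite subr_ge0 b_noninc.
by rewrite subr_le0 b_noninc // ltnW.
Qed.

Lemma abs_sortE (R : realType) (n : nat) (x : 'rV[R]_n) :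
  exists s : {perm 'I_n}, forall i, abs_sort x 0 i = x 0 (s i).
Proof.
have sz : size (sort (fun a b : R => `|b| <= `|a|) [seq x 0 j | j : 'I_n]) == n.
  by rewrite size_sort size_map size_enum_ord.
have /tuple_permP[s Es] :
    perm_eq (Tuple sz) [tuple x 0 j | j < n].
  by rewrite /= perm_sort perm_refl.
exists s => i; rewrite mxE.
rewrite -[sort _ _]/(tval (Tuple sz)) Es /= (nth_map i) ?size_enum_ord //.
by rewrite nth_ord_enum tnth_mktuple.
Qed.

Lemma abs_sort_noninc (R : realType) (n : nat) (x : 'rV[R]_n) (i j : 'I_n) :
  (i <= j)%N -> `|abs_sort x 0 j| <= `|abs_sort x 0 i|.
Proof.
move=> ij; rewrite !mxE.
apply: (@sorted_leq_nth _ (fun a b : R => `|b| <= `|a|)) => //.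
- by move=> a b c ba ac; apply: le_trans ac ba.
- by apply: sort_sorted => a b; apply: le_total.
- by rewrite inE size_sort size_map size_enum_ord.
- by rewrite inE size_sort size_map size_enum_ord.
Qed.

Lemma l1norm_trunc (R : realType) (n : nat) (x : 'rV[R]_n) (k : nat) :
  l1norm (trunc_sort k x) = \sum_(i < n | (i < k)%N) `|abs_sort x 0 i|.
Proof.
rewrite /l1norm [RHS]big_mkcond; apply: eq_bigr => i _.
by rewrite mxE; case: ifP => // _; rewrite normr0.
Qed.

Lemma sum_abs_perm_le (R : realType) (n : nat) (x : 'rV[R]_n)
    (p : {perm 'I_n}) (k : 'I_n) :
  \sum_(i < n | (i < k.+1)%N) `|x 0 (p i)| <= l1norm (trunc_sort k.+1 x).
Proof.
have [t xt] := abs_sortE x; rewrite l1norm_trunc.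
(* Position [i] of the sorted [x] holds the entry [t i], which [p] selects exactly when [p^-1] sends
   [t i] below [k.+1]. *)
have -> : \sum_(i < n | (i < k.+1)%N) `|x 0 (p i)| =
    \sum_(i < n | ((t * p^-1)%g i < k.+1)%N) `|abs_sort x 0 i|.
  rewrite [RHS](reindex_inj (@perm_inj _ (p * t^-1)%g)).
  by apply: eq_big => i; [|move=> _]; rewrite ?xt !permM ?permKV ?permK.
by apply: ler_sum_perm_lt => i j; apply: abs_sort_noninc.
Qed.

Lemma inner_le_dwsl1 (R : realType) (n : nat) (w x u : 'rV[R]_n) (M : R)
    (M_ub : forall k : 'I_n, l1norm (trunc_sort k.+1 x) <=
                             M * \sum_(i < n | (i < k.+1)%N) w 0 i) :
  inner u x <= M * dwsl1 w u.
Proof.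
have [s us] := abs_sortE u.
apply: (@le_trans _ _ (\sum_(i < n) `|abs_sort u 0 i| * `|x 0 (s i)|)).
  rewrite /inner (reindex_inj (@perm_inj _ s)); apply: ler_sum => i _.
  by rewrite us -normrM ler_norm.
rewrite -subr_ge0 /dwsl1 mulr_sumr -sumrB.
under eq_bigr => i _ do rewrite mulrA [M * _ * _]mulrC -mulrBr.
(* Here [h i] is [M * w 0 i] minus the magnitude of [x 0 (s i)]; [M_ub] makes its partial sums
   nonnegative. *)
apply: sumr_ge0_by_parts => // [i j|k]; first exact: abs_sort_noninc.
by rewrite sumrB -mulr_sumr subr_ge0 (le_trans (sum_abs_perm_le _ _ _)).
Qed.

Lemma tau_value_attained (R : realType) (n : nat) (w x : 'rV[R]_n) (k : 'I_n)
    (w_noninc : forall i j : 'I_n, (i <= j)%N -> w 0 j <= w 0 i)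
    (w_ge0 : forall i : 'I_n, 0 <= w 0 i)
    (W_gt0 : 0 < \sum_(i < n | (i < k.+1)%N) w 0 i) :
  dual_values (dwsl1 w) x (tau w k.+1 * l1norm (trunc_sort k.+1 x)).
Proof.
have tau_ge0 : 0 <= tau w k.+1 by rewrite invr_ge0 ltW.
have [s xs] := abs_sortE x.
(* [(s^-1)%g j] is the rank of the entry [j] in the sorted [x]. *)
pose u : 'rV[R]_n := \row_j
  (if ((s^-1)%g j < k.+1)%N then tau w k.+1 * Num.sg (x 0 j) else 0).
exists u => /=.
  have [t ut] := abs_sortE u.
  (* The order [t] that sorts [u] need not match [s]: ties and zero signs may intervene. It suffices
     that each magnitude is at most [tau w k.+1] and that any [k.+1] weights sum to at most the
     first [k.+1]. *)
  apply: (@le_trans _ _ (tau w k.+1 *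
      \sum_(i < n | ((t * s^-1)%g i < k.+1)%N) w 0 i)); last first.
    apply: le_trans (ler_wpM2l tau_ge0 (ler_sum_perm_lt _ _ w_noninc)) _.
    by rewrite mulVf // gt_eqF.
  rewrite /dwsl1 mulr_sumr [leRHS]big_mkcond; apply: ler_sum => i _.
  rewrite ut mxE permM; case: ifP => _; last by rewrite normr0 mulr0.
  rewrite [leRHS]mulrC ler_wpM2l // normrM (ger0_norm tau_ge0) normr_sg.
  by rewrite ler_piMr // lern1 leq_b1.
rewrite l1norm_trunc mulr_sumr big_mkcond /inner (reindex_inj (@perm_inj _ s)).
apply: eq_bigr => i _; rewrite mxE permK; case: ifP => _; last by rewrite mul0r.
by rewrite xs -mulrA -normrEsg.
Qed.

Lemma sup_is_max (R : realType) (A : set R) (m : R) : is_max A m -> sup A = m.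
Proof.
move=> [Am Aub]; apply/eqP; rewrite eq_le; apply/andP; split.
  by apply: ge_sup => //; exists m.
by apply: ub_le_sup => //; exists m.
Qed.

Theorem theorem1 (R : realType) (n : nat) (hn : (0 < n)%N) (w : 'rV[R]_n)
    (w_noninc : forall i j : 'I_n, (i <= j)%N -> w 0 j <= w 0 i)
    (w_ge0 : forall i : 'I_n, 0 <= w 0 i)
    (w1_gt0 : 0 < w 0 (Ordinal hn)) (x : 'rV[R]_n) :
  is_max (dual_values (dwsl1 w) x) (dual_norm (dwsl1 w) x) /\
  is_max [set tau w k * l1norm (trunc_sort k x) |
           k in [set k : nat | (1 <= k <= n)%N]]
         (dual_norm (dwsl1 w) x).
Proof.
have W_gt0 (k : 'I_n) : 0 < \sum_(i < n | (i < k.+1)%N) w 0 i.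
  by rewrite (bigD1 (Ordinal hn)) //= ltr_pwDl // sumr_ge0.
pose F (k : 'I_n) := tau w k.+1 * l1norm (trunc_sort k.+1 x).
have [K _ FK] := @arg_maxP _ _ _ (Ordinal hn) xpredT F isT.
(* This sign turns [dwsl1 w u <= 1] into [F K * dwsl1 w u <= F K]. *)
have FK_ge0 : 0 <= F K.
  by rewrite mulr_ge0 ?invr_ge0 ?(ltW (W_gt0 K)) ?sumr_ge0.
have dual_max : is_max (dual_values (dwsl1 w) x) (F K).
  split; first exact: tau_value_attained.
  move=> _ [u /= u1 <-].
  apply: (@le_trans _ _ (F K * dwsl1 w u)); last by rewrite ler_piMr.
  apply: inner_le_dwsl1 => k.
  (* Dividing by the positive partial sum of weights leaves [F k <= F K]. *)
  by rewrite -ler_pdivrMr // mulrC; apply: FK.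
rewrite /dual_norm (sup_is_max dual_max); split=> //; split.
  by exists K.+1 => //=; rewrite ltn_ord.
by move=> _ [[|k] //= kn <-]; apply: (FK (Ordinal kn)).
Qed.
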